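(* There exists a compact set in $\mathbb{R}^3$ of positive Lebesgue measure which is not a domain of expansion.
   Context: $\mu$ denotes Lebesgue measure on $\mathbb{R}^3$ and $\operatorname{Iso}(\mathbb{R}^3)$ is the group of isometries of $\mathbb{R}^3$. A bounded measurable set $A\subset\mathbb{R}^3$ with $\mu(A)>0$ is a domain of expansion if there exist a finite set $S\subset\operatorname{Iso}(\mathbb{R}^3)$ and $\varepsilon>0$ such that for every measurable $U\subset A$ with $0<\mu(U)\le\frac12\mu(A)$ we have $$\mu\Big(\bigcup_{s\in S}s(U)\cap A\Big)>(1+\varepsilon)\mu(U).$$ *)

(* Defs.v *)
From mathcomp Require Import all_boot all_order all_algebra.
From mathcomp Require Import all_classical all_reals all_analysis.

Set Implicit Arguments.
Unset Strict Implicit.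
Unset Printing Implicit Defensive.
Import Order.TTheory GRing.Theory Num.Theory.
Import numFieldNormedType.Exports.

Local Open Scope classical_set_scope.
Local Open Scope ring_scope.

(* R^3 as an iterated product: its library topology is the Euclidean one, but
   its library norm is the max norm, hence euclid_dist below. *)
Notation space3 R := (R * R * R)%type (only parsing).

Definition euclid_dist (R : realType) (x y : space3 R) : R :=
  Num.sqrt ((x.1.1 - y.1.1) ^+ 2 + (x.1.2 - y.1.2) ^+ 2 + (x.2 - y.2) ^+ 2).

Definition Iso3 (R : realType) : set (space3 R -> space3 R) :=
  [set f | bijective f /\
           forall x y : space3 R, euclid_dist (f x) (f y) = euclid_dist x y].

Section lebesgue.
Variable R : realType.

(* As a product measure, this is meaningful on Borel sets only. *)
Definition borel_lebesgue3 :
    {measure set (space3 (measurableTypeR R)) -> \bar R} :=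
  ((@lebesgue_measure R \x @lebesgue_measure R) \x @lebesgue_measure R)%E.

(* The completion of borel_lebesgue3; as a function on all sets it is the
   Lebesgue outer measure. *)
Definition lebesgue_measure3 : set (space3 R) -> \bar R :=
  @completed_measure_extension _ _ _ borel_lebesgue3.

(* The domain of this completion, i.e. the Lebesgue (not only Borel) measurable
   sets, given by Caratheodory's criterion. *)
Definition lebesgue_measurable3 : set (set (space3 R)) :=
  (borel_lebesgue3 ^*)%mu.-cara.-measurable.

(* This notion is meant for bounded Lebesgue measurable sets A of positive
   measure; compact sets are bounded and Lebesgue measurable. *)
Definition domain_of_expansion (A : set (space3 R)) : Prop :=
  exists (S : set (space3 R -> space3 R)) (eps : R),
    [/\ finite_set S, S `<=` @Iso3 R, 0 < eps &
        forall U : set (space3 R),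
          lebesgue_measurable3 U -> U `<=` A ->
          (0 < lebesgue_measure3 U)%E ->
          (lebesgue_measure3 U <= (2^-1)%:E * lebesgue_measure3 A)%E ->
          ((1 + eps)%:E * lebesgue_measure3 U <
             lebesgue_measure3 (\bigcup_(s in S) ((s @` U) `&` A)))%E].

End lebesgue.

(* Main.v *)
Require Import Defs.
From mathcomp Require Import all_boot all_order all_algebra.
From mathcomp Require Import all_classical all_reals all_analysis.
From mathcomp Require Import lra.
Import Order.TTheory GRing.Theory Num.Theory.
Import numFieldNormedType.Exports.
Local Open Scope classical_set_scope.
Local Open Scope ring_scope.

(** The set [A] constructed here has the following property: for finitely many
    isometries [s_1, ..., s_k], none of them the identity, there is a piece
    [U] of [A] of positive measure, at most half that of [A], such that every
    [s_i U] is disjoint from [A] ([wandering_slab]).  For an arbitrary finite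
    set of isometries, the identity only contributes [U] itself, so the union
    of the images of [U] meets [A] inside [U] and there is no expansion.

    [A] consists of the origin and of chunks [C_n] that shrink to it.  With
    [rho_n] for [scale R n], the chunk [C_n] is a cube around [(rho_n, rho_n^2, rho_n^3)], of a radius of
    the order of [rho_(n+1) = rho_n^4], from which all the points are removed
    whose first coordinate is in a periodic open set [gap j], for every [j] from
    [2n+1] on.  The set [gap j] has period [rho_j] and density of the order of
    [rho_j^3], so what remains of the cube has positive measure.

    Let [s] be an isometry other than the identity.  For large [n], a point of
    the [n]-th cube is mapped either outside [A] or to a point whose first
    coordinate avoids [gap j] for all [j >= n] ([iso_image_thin]).
    - If [s] moves the origin, the images stay away from it, so they can only
      fall in chunks [C_m] with [m] bounded, which avoid these gaps.
    - If [s] fixes the origin, it preserves inner products, and distances to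
      the origin, which for distinct chunks have different orders of magnitude.
      So the images fall outside [A], or near the [n]-th cube itself.  If
      the latter happened for infinitely many [n], then for every [y] the vector
      [s y - y] would be nearly orthogonal to infinitely many points of the moment
      curve close to the origin, hence zero ([iso_id_of_moment_pts]).

    On the other hand any cube of radius [2 rho_j] contains one of radius
    [2 rho_(j+1)] whose points a given isometry maps to points with first coordinate in
    [gap j] ([gap_step]).
    Iterating this over [s_1, ..., s_k] ([gap_steps]) inside the [n]-th cube,
    with [n >= k], uses up the gaps of index [n+1] to [n+k] only.  Since these
    gaps are not removed from [C_n], its part in the last cube still has
    positive measure, and it is the required [U]. *)

(** * Cubes and isometries *)

Definition cube {R : realType} (c : space3 R) (r : R) : set (space3 R) :=
  [set x | [/\ `|x.1.1 - c.1.1| <= r, `|x.1.2 - c.1.2| <= r & `|x.2 - c.2| <= r]].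

Definition dot3 {R : realType} (x y : space3 R) : R :=
  x.1.1 * y.1.1 + x.1.2 * y.1.2 + x.2 * y.2.

Lemma cubeC {R : realType} (x y : space3 R) (r : R) : cube x r y -> cube y r x.
Proof. by case=> h1 h2 h3; split; rewrite distrC. Qed.

Lemma cube_trans {R : realType} (x y z : space3 R) (r r' : R) :
  cube y r x -> cube z r' y -> cube z (r + r') x.
Proof.
case=> h1 h2 h3 [k1 k2 k3].
by split; apply: (le_trans (ler_distD _ _ _)); apply: lerD; eassumption.
Qed.

Lemma cubeS {R : realType} (x y : space3 R) (r r' : R) :
  r <= r' -> cube x r y -> cube x r' y.
Proof. by move=> rr' [h1 h2 h3]; split; apply: le_trans rr'. Qed.

Lemma ler_norm_sqr {R : realType} (a r : R) : `|a| <= r -> a ^+ 2 <= r ^+ 2.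
Proof.
move=> ar; rewrite -real_normK ?num_real// lerXn2r// nnegrE.
exact: le_trans ar.
Qed.

Lemma euclid_dist_ge0 {R : realType} (x y : space3 R) : 0 <= euclid_dist x y.
Proof. exact: sqrtr_ge0. Qed.

Lemma sqr_euclid_dist {R : realType} (x y : space3 R) :
  euclid_dist x y ^+ 2 =
    (x.1.1 - y.1.1) ^+ 2 + (x.1.2 - y.1.2) ^+ 2 + (x.2 - y.2) ^+ 2.
Proof. by rewrite sqr_sqrtr// !addr_ge0// sqr_ge0. Qed.

Lemma cube_euclid_dist {R : realType} (x y : space3 R) (r : R) :
  cube y r x -> euclid_dist x y <= 2 * r.
Proof.
case=> h1 h2 h3; have r0 : 0 <= r by apply: le_trans h1.
rewrite -(@ler_pXn2r _ 2)// ?nnegrE ?euclid_dist_ge0 ?mulr_ge0//.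
rewrite sqr_euclid_dist.
have := ler_norm_sqr _ _ h1; have := ler_norm_sqr _ _ h2.
have := ler_norm_sqr _ _ h3; have := sqr_ge0 r; nra.
Qed.

Lemma euclid_dist_cube {R : realType} (x y : space3 R) (r : R) :
  euclid_dist x y <= r -> cube y r x.
Proof.
move=> dr; have r0 : 0 <= r by apply: le_trans dr; exact: euclid_dist_ge0.
have := ler_norm_sqr (euclid_dist x y) r.
rewrite ger0_norm ?euclid_dist_ge0// => /(_ dr); rewrite sqr_euclid_dist => h.
have h1 := sqr_ge0 (x.1.1 - y.1.1); have h2 := sqr_ge0 (x.1.2 - y.1.2).
have h3 := sqr_ge0 (x.2 - y.2).
by split; rewrite -(@ler_pXn2r _ 2)// ?nnegrE// real_normK ?num_real//; lra.
Qed.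

Lemma iso_cube {R : realType} (s : space3 R -> space3 R) (x y : space3 R) (r : R) :
  Iso3 s -> cube y r x -> cube (s y) (2 * r) (s x).
Proof.
by case=> _ sI /cube_euclid_dist h; apply: euclid_dist_cube; rewrite sI.
Qed.

Lemma iso_cube_inv {R : realType} (s : space3 R -> space3 R) (x y : space3 R) (r : R) :
  Iso3 s -> cube (s y) r (s x) -> cube y (2 * r) x.
Proof.
by case=> _ sI /cube_euclid_dist h; apply: euclid_dist_cube; rewrite -sI.
Qed.

(** Polarization of the squared distances, which turns the distances to the
    origin and between the two points into their inner product. *)
Lemma iso_dot3 {R : realType} (s : space3 R -> space3 R) :
  Iso3 s -> s (0, 0, 0) = (0, 0, 0) -> forall x y, dot3 (s x) (s y) = dot3 x y.
Proof.
move=> [_ sI] s0 x y.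
have E u v : euclid_dist (s u) (s v) ^+ 2 = euclid_dist u v ^+ 2 by rewrite sI.
have := E x y; have := E x (0, 0, 0); have := E y (0, 0, 0).
rewrite s0 !sqr_euclid_dist /dot3 /=; nra.
Qed.

(** * Scales, gaps and the set *)

(** The scales are inverses of integers, so that finitely many translates of
    an interval cover the part of a gap in [[-1, 1]], with an exact count. *)
Fixpoint cells (n : nat) : nat := if n is m.+1 then (cells m ^ 4)%N else 16.

Definition scale (R : realType) (n : nat) : R := (cells n)%:R^-1.

Lemma cells_ge16 n : (16 <= cells n)%N.
Proof.
elim: n => // n IHn; rewrite [cells _]/=; apply: (leq_trans IHn).
by rewrite -[X in (X <= _)%N]expn1 leq_pexp2l// (leq_trans _ IHn).
Qed.

Lemma cells_gt0 n : (0 < cells n)%N.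
Proof. by rewrite (leq_trans _ (cells_ge16 n)). Qed.

Lemma scale_gt0 (R : realType) n : 0 < scale R n.
Proof. by rewrite invr_gt0 ltr0n cells_gt0. Qed.

Lemma scaleS (R : realType) n : scale R n.+1 = scale R n ^+ 4.
Proof. by rewrite /scale [cells _]/= natrX exprVn. Qed.

Lemma scale_le16 (R : realType) n : scale R n <= 16^-1.
Proof. by rewrite lef_pV2 ?posrE ?ltr0n ?cells_gt0// ler_nat cells_ge16. Qed.

Lemma scaleS_le (R : realType) n : scale R n.+1 <= scale R n / 4096.
Proof.
rewrite scaleS; have p := scale_gt0 R n; have h := scale_le16 R n.
have h2 : scale R n ^+ 2 <= 256^-1 by nra.
have h3 : scale R n ^+ 3 <= 4096^-1 by rewrite exprS; nra.
by rewrite exprSr mulrC ler_pM2l.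
Qed.

Lemma le_scale (R : realType) m n : (m <= n)%N -> scale R n <= scale R m.
Proof.
move=> /subnK <-; elim: (n - m)%N => // k IHk; rewrite addSn.
by have := scaleS_le R (k + m); have := scale_gt0 R (k + m); lra.
Qed.

Lemma lt_scale (R : realType) m n : (m < n)%N -> scale R n <= scale R m / 4096.
Proof. by move=> mn; apply: le_trans (scaleS_le R m); exact: le_scale. Qed.

Lemma scale_add_le (R : realType) m i : scale R (m + i) <= scale R m / 2 ^+ i.
Proof.
elim: i => [|i IHi]; first by rewrite addn0 expr0 divr1.
rewrite addnS exprSr invfM mulrA.
have := scaleS_le R (m + i); have := scale_gt0 R (m + i); lra.
Qed.

Lemma scale_small (R : realType) (e : R) : 0 < e -> exists n, scale R n < e.
Proof.
move=> e0; have [k ke] : exists k, (k.+1%:R)^-1 < e.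
  exists (Num.bound e^-1); rewrite invf_plt ?posrE// ?ltr0n//.
  have ei : 0 <= e^-1 by rewrite invr_ge0 ltW.
  by apply: (lt_le_trans (archi_boundP ei)); rewrite ler_nat.
exists k; apply: le_lt_trans ke.
rewrite lef_pV2 ?posrE ?ltr0n ?cells_gt0// ler_nat.
elim: k => // k IHk; rewrite [cells _]/= (leq_ltn_trans IHk)//.
by rewrite -[X in (X < _)%N]expn1 ltn_exp2l// (leq_trans _ (cells_ge16 k)).
Qed.

(** The half-width exceeds [4 rho_(j+1)], which bounds how far an isometry
    moves the points of a cube of radius [2 rho_(j+1)] from the image of the
    centre. *)
Definition gap (R : realType) (j : nat) : set R :=
  [set t | exists k : int, `|t - k%:~R * scale R j| < 5 * scale R j.+1].

Definition thin (R : realType) (J : nat) : set R :=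
  [set t | forall j, (J <= j)%N -> ~ gap R j t].

Definition slab {R : realType} (c : space3 R) (r : R) J : set (space3 R) :=
  cube c r `&` [set x | thin R J x.1.1].

Definition moment_pt (R : realType) (n : nat) : space3 R :=
  (scale R n, scale R n ^+ 2, scale R n ^+ 3).

Definition chunk (R : realType) (n : nat) : set (space3 R) :=
  slab (moment_pt R n) (2 * scale R n.+1) n.*2.+1.

(** The union of the chunks and of the origin.  This form displays it as an
    intersection of finite unions of closed sets. *)
Definition rigid_set (R : realType) : set (space3 R) :=
  [set x | forall N, (exists2 n, (n < N)%N & chunk R n x) \/
                     cube (0, 0, 0) (2 * scale R N) x].

(** The two bounds show that the chunks have distances to the origin of
    different orders of magnitude, because [rho_(n+1)] is much less than
    [rho_n]. *)
Lemma cube_moment_pt (R : realType) n x : cube (moment_pt R n) (2 * scale R n.+1) x ->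
  scale R n / 2 <= x.1.1 /\ cube (0, 0, 0) (2 * scale R n) x.
Proof.
case; rewrite /moment_pt /= !ler_distl => /andP[h1 h1'] /andP[h2 h2'] /andP[h3 h3'].
have p := scale_gt0 R n; have h := scale_le16 R n; have hS := scaleS_le R n.
have pS := scale_gt0 R n.+1.
have hh : 0 <= scale R n ^+ 2 <= scale R n / 16 by nra.
have hhh : 0 <= scale R n ^+ 3 <= scale R n / 16 by rewrite exprS; nra.
split; first by lra.
by split; rewrite /= subr0 ler_norml; lra.
Qed.

Lemma chunk_rigid (R : realType) n : chunk R n `<=` rigid_set R.
Proof.
move=> x xn N; have [nN|Nn] := ltnP n N; first by left; exists n.
right; case: xn => /cube_moment_pt[_ h] _; apply: cubeS h.
by rewrite ler_pM2l// le_scale.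
Qed.

(** * Isometries displacing the chunks *)

(** The monomials [a, a^2, a^3] have different orders of magnitude as [a] tends
    to 0, so the coefficients vanish one after the other. *)
Lemma moment_curve_coef0 (R : realType) (w1 w2 w3 L : R) :
  0 <= L ->
  (forall d, 0 < d -> exists2 a, 0 < a < d &
     `|w1 * a + w2 * a ^+ 2 + w3 * a ^+ 3| <= L * a ^+ 4) ->
  [/\ w1 = 0, w2 = 0 & w3 = 0].
Proof.
move=> L0 H.
have key (w B : R) : 0 <= B ->
    (forall a, 0 < a < 1 -> `|w1 * a + w2 * a ^+ 2 + w3 * a ^+ 3| <= L * a ^+ 4 ->
       `|w| <= B * a) -> w = 0.
  move=> B0 h; apply/eqP; rewrite -normr_eq0; apply/negPn/negP => w0.
  have wp : 0 < `|w| by rewrite lt_def w0 normr_ge0.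
  have Bp : 0 < B + 1 by lra.
  have [|a /andP[a0 ad] ha] := H (Num.min (`|w| / (B + 1)) 1).
    by rewrite lt_min divr_gt0// ltr01.
  move: ad; rewrite lt_min => /andP[ad a1].
  have := h a; rewrite a0 a1 => /(_ isT ha).
  by move: ad; rewrite ltr_pdivlMr//; nra.
have divide (a y c : R) : 0 < a -> `|y * a| <= c * a -> `|y| <= c.
  by move=> a0; rewrite normrM (gtr0_norm a0) ler_pM2r.
have split_ (w v y a : R) : 0 < a -> `|v + w * a| <= y -> `|v| <= y + `|w| * a.
  move=> a0 h; have -> : v = (v + w * a) - w * a by lra.
  apply: (le_trans (ler_normB _ _)).
  by rewrite normrM (gtr0_norm a0) lerD2r.
have e1 : w1 = 0.
  apply: (key _ (L + `|w2| + `|w3|)); first by rewrite !addr_ge0.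
  move=> a /andP[a0 a1] h.
  have {}h : `|w1 + (w2 + w3 * a) * a| <= L * a ^+ 3.
    apply: (divide a) => //; have -> : L * a ^+ 3 * a = L * a ^+ 4 by lra.
    by apply: le_trans h; rewrite le_eqVlt; apply/orP; left; apply/eqP; congr `|_|; lra.
  have /(split_ _ _ _ _ a0) h1 := h.
  have v1 : `|w2 + w3 * a| <= `|w2| + `|w3|.
    apply: (le_trans (ler_normD _ _)); rewrite normrM (gtr0_norm a0) lerD2l.
    by rewrite ler_piMr// ltW.
  have a21 : a ^+ 2 <= 1 by nra.
  have La : L * a ^+ 3 <= L * a by rewrite ler_wpM2l// exprS ler_piMr// ltW.
  have := ler_wpM2r (ltW a0) v1; lra.
have e2 : w2 = 0.
  apply: (key _ (L + `|w3|)); first by rewrite !addr_ge0.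
  move=> a /andP[a0 a1] h.
  have {}h : `|w2 + w3 * a| <= L * a ^+ 2.
    apply: (divide a) => //; apply: (divide a) => //.
    have -> : L * a ^+ 2 * a * a = L * a ^+ 4 by lra.
    apply: le_trans h; rewrite e1 le_eqVlt; apply/orP; left; apply/eqP.
    by congr `|_|; lra.
  have /(split_ _ _ _ _ a0) h1 := h.
  have La : L * a ^+ 2 <= L * a by rewrite ler_wpM2l// exprS ler_piMr// ltW.
  lra.
split => //; apply: (key _ L L0) => a /andP[a0 a1] h.
do 3! apply: (divide a) => //.
have -> : L * a * a * a * a = L * a ^+ 4 by lra.
by apply: le_trans h; rewrite e1 e2 le_eqVlt; apply/orP; left; apply/eqP; congr `|_|; lra.
Qed.

(** With [w = s y - y] and [c] the centre of the cube, [s y . s x = y . x] shows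
    that [w . c] is bounded by a constant times the radius of the cube, which is
    of order 4 in the parameter of the moment curve. *)
Lemma iso_id_of_moment_pts (R : realType) (s : space3 R -> space3 R) :
  Iso3 s -> s (0, 0, 0) = (0, 0, 0) ->
  (forall N, exists n x, [/\ (N <= n)%N, cube (moment_pt R n) (2 * scale R n.+1) x &
     cube (moment_pt R n) (2 * scale R n.+1) (s x)]) ->
  forall y, s y = y.
Proof.
move=> sI s0 H y.
pose l1 (z : space3 R) := `|z.1.1| + `|z.1.2| + `|z.2|.
have l1_ge0 z : 0 <= l1 z by rewrite !addr_ge0.
have dot_le z u v r : cube u r v -> `|dot3 z u - dot3 z v| <= l1 z * r.
  move=> [h1 h2 h3].
  have -> : dot3 z u - dot3 z v =
    z.1.1 * (u.1.1 - v.1.1) + z.1.2 * (u.1.2 - v.1.2) + z.2 * (u.2 - v.2).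
    by rewrite /dot3; lra.
  apply: (le_trans (ler_normD _ _)); rewrite /l1 2!mulrDl lerD//; last first.
    by rewrite normrM ler_wpM2l// distrC.
  apply: (le_trans (ler_normD _ _)); rewrite lerD//.
    by rewrite normrM ler_wpM2l// distrC.
  by rewrite normrM ler_wpM2l// distrC.
have [] := @moment_curve_coef0 R ((s y).1.1 - y.1.1) ((s y).1.2 - y.1.2)
  ((s y).2 - y.2) (2 * (l1 (s y) + l1 y)).
- by rewrite mulr_ge0// addr_ge0.
- move=> d /scale_small[N Nd]; have [n [x [Nn xn sxn]]] := H N.
  exists (scale R n); first by rewrite scale_gt0/= (le_lt_trans _ Nd)// le_scale.
  have := dot_le (s y) _ _ _ sxn; have := dot_le y _ _ _ xn.
  rewrite iso_dot3// scaleS.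
  set p := dot3 y x; move=> h1 h2.
  have -> : 2 * (l1 (s y) + l1 y) * scale R n ^+ 4 =
    l1 (s y) * (2 * scale R n ^+ 4) + l1 y * (2 * scale R n ^+ 4) by lra.
  apply: le_trans (lerD h2 h1); apply: le_trans (ler_normB _ _).
  rewrite /dot3 /moment_pt /= le_eqVlt; apply/orP; left; apply/eqP.
  by congr `|_|; lra.
case: (s y) => [[a b] c]; case: y => [[a' b'] c'] /=.
by move=> /subr0_eq-> /subr0_eq-> /subr0_eq->.
Qed.

(** The alternative between an isometry that moves the origin and one that fixes
    it; in the second case the hypothesis that the image is in the set is
    contradictory. *)
Lemma iso_image_thin (R : realType) (s : space3 R -> space3 R) :
  Iso3 s -> (exists y, s y <> y) ->
  exists N, forall n x, (N <= n)%N -> cube (moment_pt R n) (2 * scale R n.+1) x ->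
    rigid_set R (s x) -> thin R n (s x).1.1.
Proof.
move=> sI [y sy]; have [s0|s0] := pselect (s (0, 0, 0) = (0, 0, 0)); last first.
  have [e e0 He] : exists2 e, 0 < e & forall r, cube (0, 0, 0) r (s (0, 0, 0)) -> e <= r.
    pose z := s (0, 0, 0); exists (Num.max `|z.1.1| (Num.max `|z.1.2| `|z.2|)).
      rewrite !lt_max !normr_gt0; apply/negPn/negP; rewrite !negb_or !negbK.
      move=> /and3P[/eqP h1 /eqP h2 /eqP h3]; apply: s0; rewrite -/z.
      by move: h1 h2 h3; case: z => [[a b] c] /= -> -> ->.
    by move=> r [/=]; rewrite !subr0 => h1 h2 h3; rewrite !ge_max h1 h2 h3.
  have [M Me] : exists M, scale R M < e / 6.
    by apply: scale_small; rewrite divr_gt0.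
  (* The images are in chunks of index less than M, which avoid every gap of
     index at least 2M + 1. *)
  exists M.*2.+1 => n x Mn xn /(_ M)[].
    case=> m mM [_ sxm] j nj; apply: sxm; apply: leq_trans nj.
    by apply: leq_trans Mn; rewrite ltnS leq_double ltnW.
  move=> sxM; have [_ x0] := cube_moment_pt _ _ _ xn.
  have /cubeC sx0 := iso_cube _ _ _ _ sI x0.
  have := He _ (cube_trans _ _ _ _ _ sx0 sxM).
  have := le_scale R M n; rewrite (leq_trans _ Mn); last first.
    by rewrite ltnW// ltnS -addnn leq_addr.
  by clear s0 sy => /(_ isT) *; lra.
have [/(iso_id_of_moment_pts _ _ sI s0)/(_ y)//|] := pselect (forall N, exists n x,
  [/\ (N <= n)%N, cube (moment_pt R n) (2 * scale R n.+1) x &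
     cube (moment_pt R n) (2 * scale R n.+1) (s x)]).
move=> {sy} /existsNP[N /forallNP HN]; exists N => n x Nn xn sxA; exfalso.
have [x1 x0] := cube_moment_pt _ _ _ xn.
have sx0 := iso_cube _ _ _ _ sI x0.
have x_sx r := iso_cube_inv s x (0, 0, 0) r sI.
rewrite s0 in sx0 x_sx; clear s0.
have pn := scale_gt0 R n; have pnS := lt_scale R n n.+1 (leqnn _).
have [[m mn [sxm _]]|sxS] := sxA n.+1; last first.
  have [/=] := x_sx _ sxS.
  by rewrite subr0 ler_norml => /andP[_ ?] _ _; lra.
have [smx1 _] := cube_moment_pt _ _ _ sxm.
move: mn; rewrite ltnS leq_eqVlt => /orP[/eqP mn|mn].
  by apply: (HN n); exists x; split => //; rewrite -{1 2}mn.
case: sx0 => /=; rewrite subr0 ler_norml => /andP[_ ?] _ _.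
by have := lt_scale R m n mn; lra.
Qed.

(** * Small cubes mapped into the gaps *)

(** The gap [j] has a midpoint within [rho_j] of the first coordinate of the image
    of the centre; the new centre is the preimage of the point obtained by
    changing this coordinate to the midpoint. *)
Lemma gap_step (R : realType) (s : space3 R -> space3 R) (c : space3 R) j :
  Iso3 s -> exists2 c', cube c' (2 * scale R j.+1) `<=` cube c (2 * scale R j) &
    forall x, cube c' (2 * scale R j.+1) x -> gap R j (s x).1.1.
Proof.
move=> sI; have [[g sK gK] sdist] := sI.
pose k := Num.floor ((s c).1.1 / scale R j).
have p := scale_gt0 R j; have pS := scale_gt0 R j.+1; have hS := scaleS_le R j.
pose z : space3 R := (k%:~R * scale R j, (s c).1.2, (s c).2).
have zc : euclid_dist z (s c) <= scale R j.
  rewrite /euclid_dist /z /= !subrr expr0n/= !addr0 sqrtr_sqr.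
  have /andP[h1 h2] := floor_itv ((s c).1.1 / scale R j).
  move: h1 h2; rewrite -/k ler_pdivlMr// ltr_pdivrMr// intrD.
  move=> h1 h2; rewrite ler_norml; apply/andP; split; nra.
have gc : cube c (scale R j) (g z).
  by apply: euclid_dist_cube; rewrite -sdist gK.
exists (g z) => x xz.
  by apply: cubeS (cube_trans _ _ _ _ _ xz gc); lra.
have := iso_cube _ _ _ _ sI xz; rewrite gK => -[xk _ _]; exists k.
by apply: le_lt_trans xk _; lra.
Qed.

(** One scale is spent on each isometry; the earlier ones keep their gap because
    the cubes are nested. *)
Lemma gap_steps (R : realType) (ss : seq (space3 R -> space3 R)) (c : space3 R) j :
  (forall s, s \in ss -> Iso3 s) ->
  exists2 c', cube c' (2 * scale R (j + size ss)) `<=` cube c (2 * scale R j) &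
    forall s x, s \in ss -> cube c' (2 * scale R (j + size ss)) x ->
      exists2 i, (j <= i)%N & gap R i (s x).1.1.
Proof.
elim: ss j c => [|s ss IH] j c ssI; first by exists c => //=; rewrite addn0.
have [|c1 c1c gap1] := @gap_step R s c j; first exact/ssI/mem_head.
have [|c2 c2c1 gap2] := IH j.+1 c1.
  by move=> t tss; apply: ssI; rewrite in_cons tss orbT.
rewrite /= addnS -addSn; exists c2; first exact: subset_trans c2c1 c1c.
move=> t x; rewrite in_cons => /predU1P[->|tss] xc2.
  by exists j => //; exact/gap1/c2c1.
by have [i ji ti] := gap2 _ _ tss xc2; exists i => //; exact: ltnW.
Qed.

(** * Compactness *)

Lemma closed_thin (R : realType) J : closed (thin R J).
Proof.
have -> : thin R J = \bigcap_(j in [set j | (J <= j)%N])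
    ~` \bigcup_(k in @setT int) ball (k%:~R * scale R j) (5 * scale R j.+1).
  apply/seteqP; split=> t tt j Jj /=.
    move=> [k _ tk]; apply: (tt j Jj); exists k.
    by move: tk; rewrite -ball_normE /= distrC.
  move=> [k tk]; apply: (tt j Jj); exists k => //.
  by rewrite -ball_normE /= distrC.
apply: closed_bigI => j _; apply: open_closedC; apply: bigcup_open => k _.
exact: ball_open.
Qed.

Lemma cubeE {R : realType} (c : space3 R) (r : R) : cube c r =
  `[c.1.1 - r, c.1.1 + r] `*` `[c.1.2 - r, c.1.2 + r] `*` `[c.2 - r, c.2 + r].
Proof.
apply/seteqP; split=> x; rewrite /cube /= !in_itv /= !ler_distl.
  by move=> [h1 h2 h3].
by move=> [[h1 h2] h3].
Qed.

Lemma slabE {R : realType} (c : space3 R) (r : R) J : slab c r J =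
  (`[c.1.1 - r, c.1.1 + r] `&` thin R J) `*` `[c.1.2 - r, c.1.2 + r]
     `*` `[c.2 - r, c.2 + r].
Proof.
rewrite /slab cubeE; apply/seteqP; split=> x /=.
  by move=> [[[? ?] ?] ?].
by move=> [[[? ?] ?] ?].
Qed.

Lemma closed_setX (T U : topologicalType) (A : set T) (B : set U) :
  closed A -> closed B -> closed (A `*` B).
Proof.
move=> cA cB; have -> : A `*` B = (fst @^-1` A) `&` (snd @^-1` B) by [].
by apply: closedI; apply: preimage_closed => // x _; [exact: cvg_fst|exact: cvg_snd].
Qed.

Lemma closed_cube {R : realType} (c : space3 R) (r : R) : closed (cube c r).
Proof. by rewrite cubeE; do 2?apply: closed_setX; exact: itv_closed. Qed.

Lemma closed_slab {R : realType} (c : space3 R) (r : R) J : closed (slab c r J).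
Proof.
rewrite slabE; apply: closed_setX; last exact: itv_closed.
apply: closed_setX; last exact: itv_closed.
by apply: closedI; [exact: itv_closed|exact: closed_thin].
Qed.

Lemma compact_cube {R : realType} (c : space3 R) (r : R) : compact (cube c r).
Proof.
by rewrite cubeE; do 2?apply: compact_setX; exact: segment_compact.
Qed.

Lemma compact_rigid_set (R : realType) : compact (rigid_set R).
Proof.
apply: (subclosed_compact _ (compact_cube (0, 0, 0) (2 * scale R 0))).
  have -> : rigid_set R = \bigcap_(N in [set: nat])
      ((\bigcup_(n in [set n | (n < N)%N]) chunk R n) `|`
       cube (0, 0, 0) (2 * scale R N)).
    apply/seteqP; split=> x xA N.
      by move=> _; have [[n nN xn]|] := xA N; [left; exists n|right].
    by have [[n nN xn]|] := xA N I; [left; exists n|right].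
  apply: closed_bigI => N _; apply: closedU.
    by apply: closed_bigcup => [|n _]; [exact: finite_II|exact: closed_slab].
  exact: closed_cube.
by move=> x /(_ 0%N)[[]|].
Qed.

(** * Measure estimates *)

Local Notation leb := (@lebesgue_measure _).

Lemma measurable_thin (R : realType) J : measurable (thin R J : set (measurableTypeR R)).
Proof. apply: measurable_realfun.closed_measurable. exact: closed_thin. Qed.

Lemma measurable_gap (R : realType) j : measurable (gap R j : set (measurableTypeR R)).
Proof.
have -> : gap R j = \bigcup_(k in @setT int) ball (k%:~R * scale R j) (5 * scale R j.+1).
  by apply/seteqP; split=> t [k] => [tk|_ tk]; exists k => //;
    move: tk; rewrite -ball_normE /= distrC.
apply: measurable_realfun.open_measurable; apply: bigcup_open => k _; exact: ball_open.
Qed.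

(** There are [2 K + 1] intervals of length [10 rho_j^4], where [K = 1 / rho_j];
    this is of order [rho_j^3]. *)
Lemma gap_measure (R : realType) j :
  (leb (gap R j `&` `[(-1)%R, 1%R]) <= (scale R j / 2)%:E)%E.
Proof.
pose F i : set (measurableTypeR R) :=
  ball ((i%:R - (cells j)%:R) * scale R j) (5 * scale R j.+1).
have p := scale_gt0 R j; have pS := scale_gt0 R j.+1; have hS := scaleS_le R j.
have K0 : 0 < (cells j)%:R :> R by rewrite ltr0n cells_gt0.
have Kp : (cells j)%:R * scale R j = 1 by rewrite /scale divff// gt_eqF.
have sub : gap R j `&` `[(-1)%R, 1%R] `<=` \big[setU/set0]_(i < (cells j).*2.+1) F i.
  move=> t [[k tk]]; rewrite /= in_itv /= => /andP[t1 t2].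
  have kK : `|k| <= (cells j)%:Z.
    rewrite -ltzD1 -(ltr_int R) intr_norm intrD -pmulrn ltr_norml.
    move: tk; rewrite ltr_distl => /andP[k1 k2].
    by apply/andP; split; rewrite -(ltr_pM2r p) ?mulNr mulrDl Kp; lra.
  have [i ki] : exists i : nat, k = i%:Z - (cells j)%:Z.
    exists (absz (k + (cells j)%:Z)); rewrite gez0_abs ?addrK//.
    by move: kK; rewrite ler_norml; lra.
  have iK : (i < (cells j).*2.+1)%N.
    move: kK; rewrite ki ler_norml ltnS => /andP[_].
    by rewrite lerBlDr -PoszD lez_nat addnn.
  rewrite -bigcup_mkord; exists i => //.
  by move: tk; rewrite ki intrB /F -ball_normE /= distrC.
have mF i : measurable (F i).
  by apply: measurable_realfun.open_measurable; exact: ball_open.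
have m1 : measurable (gap R j `&` `[(-1)%R, 1%R] : set (measurableTypeR R)).
  by apply: measurableI; [exact: measurable_gap|exact: measurable_itv].
have := content_subadditive leb (fun i _ => mF i) m1 sub.
move=> /le_trans; apply.
have Fle i : (leb (F i) <= (10 * scale R j.+1)%:E)%E.
  have r0 : 0 <= 5 * scale R j.+1 by lra.
  by rewrite (lebesgue_measure_ball _ r0) lee_fin; lra.
apply: (@le_trans _ _ (\sum_(i < (cells j).*2.+1) (10 * scale R j.+1)%:E)%E).
  by apply: lee_sum => i _; exact: Fle.
rewrite sumEFin lee_fin sumr_const card_ord scaleS.
rewrite -(mulr_natl _ (cells j).*2.+1) -(addn1 (cells j).*2) -mul2n natrD natrM.
have h := scale_le16 R j.
have -> : (2%:R * (cells j)%:R + 1) * (10 * scale R j ^+ 4) =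
  10 * (2 * ((cells j)%:R * scale R j) + scale R j) * scale R j ^+ 3 by lra.
rewrite Kp; have h2 : scale R j ^+ 2 <= 256^-1 by nra.
have h2' : 0 <= scale R j ^+ 2 by nra.
by rewrite exprS; nra.
Qed.

Lemma itv_measure (R : realType) (a r : R) : 0 <= r ->
  leb (`[a - r, a + r] : set R) = (2 * r)%:E.
Proof.
move=> r0; rewrite lebesgue_measure_itv /= lte_fin.
by case: ifPn => [_|]; rewrite -?EFinB ?EFinN; [congr EFin|move=> ?; congr EFin]; lra.
Qed.

(** The gaps from index [J] on cover at most [rho_J (1/2 + 1/4 + ...) = rho_J] of
    [[-1, 1]]. *)
Lemma thin_measure (R : realType) J (a r : R) : 0 <= r -> `|a| + r <= 1 ->
  ((2 * r - scale R J)%:E <= leb (`[(a - r)%R, (a + r)%R] `&` thin R J))%E.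
Proof.
move=> r0 ar; pose I : set (measurableTypeR R) := `[(a - r)%R, (a + r)%R]%classic.
pose V i : set (measurableTypeR R) := gap R (J + i) `&` `[(-1)%R, 1%R].
have mV i : measurable (V i).
  by apply: measurableI; [exact: measurable_gap|exact: measurable_itv].
have mI : measurable I by exact: measurable_itv.
have mT : measurable (I `&` thin R J).
  by apply: measurableI => //; exact: measurable_thin.
have mVV : measurable (\bigcup_i V i) by exact: bigcupT_measurable.
have sub : I `<=` (I `&` thin R J) `|` \bigcup_i V i.
  move=> t It; have [tJ|] := pselect (thin R J t); first by left.
  move=> /existsNP[j /not_implyP[Jj /contrapT tj]]; right.
  exists (j - J)%N => //; split; first by rewrite subnKC.
  move: (It : (t : R) \in `[a - r, a + r]); rewrite in_itv /= => /andP[h1 h2].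
  change ((t : R) \in `[(- 1), 1]); rewrite in_itv /=.
  have := ler_norm a; have := lerNnormlW (lexx `|a|) => ? ?.
  by apply/andP; split; lra.
have Vle : (leb (\bigcup_i V i) <= (scale R J)%:E)%E.
  apply: (le_trans (measure_sigma_subadditive leb mV mVV (@subset_refl _ _))).
  apply: (@le_trans _ _ (\sum_(0 <= i <oo) (scale R J / (2 ^ (i + 1))%:R)%:E)%E).
    apply: lee_nneseries => // i _; apply: (le_trans (gap_measure _ _)).
    rewrite lee_fin addn1 expnSr natrM invfM mulrA ler_pM2r ?invr_gt0//.
    by rewrite natrX scale_add_le.
  have := @cvg_geometric_eseries_half R (scale R J) 0.
  by move=> /cvg_lim ->//; rewrite expr0 divr1.
have : (leb I <= leb (I `&` thin R J) + leb (\bigcup_i V i))%E.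
  apply: le_trans (measureU2 leb mT mVV).
  by apply: le_measure sub; rewrite inE//; exact: measurableU.
rewrite itv_measure// => h; rewrite EFinB leeBlDr//.
by apply: (le_trans h); rewrite leeD2l.
Qed.

Lemma slab_measurable (R : realType) (c : space3 R) (r : R) J :
  measurable (slab c r J : set (space3 (measurableTypeR R))).
Proof.
rewrite slabE; apply: measurableX; last exact: measurable_itv.
apply: measurableX; last exact: measurable_itv.
by apply: measurableI; [exact: measurable_itv|exact: measurable_thin].
Qed.

Lemma slab_measure (R : realType) (c : space3 R) (r : R) J :
  0 <= r -> `|c.1.1| + r <= 1 ->
  (((2 * r - scale R J) * (2 * r) ^+ 2)%:E <= lebesgue_measure3 (slab c r J)
    <= ((2 * r) ^+ 3)%:E)%E.
Proof.
move=> r0 cr.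
have mI (a b : R) : measurable (`[a, b]%classic : set (measurableTypeR R)).
  exact: measurable_itv.
have mT : measurable (`[(c.1.1 - r)%R, (c.1.1 + r)%R]%classic `&` thin R J
    : set (measurableTypeR R)).
  by apply: measurableI => //; exact: measurable_thin.
have -> : lebesgue_measure3 (slab c r J) = borel_lebesgue3 R (slab c r J).
  rewrite /lebesgue_measure3 /completed_measure_extension.
  by rewrite measurable_mu_extE//; exact: slab_measurable.
rewrite slabE.
have box (A B C : set (measurableTypeR R)) :
    measurable A -> measurable B -> measurable C ->
    borel_lebesgue3 R (A `*` B `*` C) = (leb A * leb B * leb C)%E.
  move=> mA mB mC.
  etransitivity; first by apply: product_measure1E => //; exact: measurableX.
  by congr (_ * _)%E; exact: product_measure1E.
rewrite box// !itv_measure//.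
have h1 := thin_measure _ J _ _ r0 cr.
have h2 : (leb (`[(c.1.1 - r)%R, (c.1.1 + r)%R] `&` thin R J) <= (2 * r)%:E)%E.
  by rewrite -(itv_measure _ c.1.1)//; apply: le_measure; rewrite ?inE.
have r2 : 0 <= 2 * r by rewrite mulr_ge0.
apply/andP; split.
  by rewrite expr2 mulrA !EFinM !lee_wpmul2r ?lee_fin.
by rewrite exprSr expr2 !EFinM !lee_wpmul2r ?lee_fin.
Qed.

(** * Absence of expansion *)

Lemma eventually_all (T : eqType) (ss : seq T) (P : T -> nat -> Prop) :
  (forall s, s \in ss -> exists N, forall n, (N <= n)%N -> P s n) ->
  exists N, forall n, (N <= n)%N -> forall s, s \in ss -> P s n.
Proof.
elim: ss => [|s ss IH] H; first by exists 0%N.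
have [N1 h1] := H s (mem_head _ _).
have [|N2 h2] := IH; first by move=> t tss; apply: H; rewrite in_cons tss orbT.
exists (maxn N1 N2) => n; rewrite geq_max => /andP[n1 n2] t.
by rewrite in_cons => /predU1P[->|/h2]; [exact: h1|exact].
Qed.

(** The slab comes from [gap_steps] in the [n]-th cube, for a large [n]: each
    isometry maps its points to points with first coordinate in a gap of index
    more than [n], hence outside the set by [iso_image_thin].  The conditions on
    [J] and [c] serve to estimate the measure of the slab. *)
Lemma wandering_slab (R : realType) (ss : seq (space3 R -> space3 R)) :
  (forall s, s \in ss -> Iso3 s /\ exists y, s y <> y) ->
  exists c J, [/\ (1 < J)%N, `|c.1.1| + 2 * scale R J <= 1,
    slab c (2 * scale R J) J `<=` rigid_set R &
    forall s x, s \in ss -> slab c (2 * scale R J) J x -> ~ rigid_set R (s x)].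
Proof.
move=> ssI.
have [|N HN] := @eventually_all _ ss
  (fun s n => forall x, cube (moment_pt R n) (2 * scale R n.+1) x ->
    rigid_set R (s x) -> thin R n (s x).1.1).
  move=> s /ssI[sI sid]; have [N HN] := iso_image_thin _ _ sI sid.
  by exists N => n Nn x; exact: HN.
(* n >= size ss leaves a gap for each isometry before those removed from the
   chunk, and n >= 1 makes the slab small compared with the chunk of index 0. *)
pose n := maxn N (maxn 1 (size ss)).
have Nn : (N <= n)%N by rewrite leq_maxl.
have n1 : (0 < n)%N by rewrite !leq_max orbT.
have ssn : (size ss <= n)%N by rewrite !leq_max leqnn !orbT.
have [|c c_n gapc] := @gap_steps R ss (moment_pt R n) n.+1; first by move=> s /ssI[].
have Jn : (n.+1 + size ss <= n.*2.+1)%N by rewrite addSn ltnS -addnn leq_add2l.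
have subc : cube c (2 * scale R n.*2.+1) `<=` cube c (2 * scale R (n.+1 + size ss)).
  by move=> x; apply: cubeS; rewrite ler_pM2l// le_scale.
have cc r : 0 <= r -> cube c r c by move=> r0; split; rewrite subrr normr0.
exists c, n.*2.+1; split.
- by rewrite ltnS double_gt0.
- have := c_n _ (cc _ (mulr_ge0 _ (ltW (scale_gt0 R _)))).
  move=> /(_ (ler0n _ _)) /cube_moment_pt[_ [+ _ _]]; rewrite subr0.
  by have := scale_le16 R n; have := scale_le16 R n.*2.+1; lra.
- by move=> x [xc xJ]; apply: (@chunk_rigid R n); split => //; exact/c_n/subc.
move=> s x sss [xc _] sxA; have [i ni] := gapc s x sss (subc _ xc).
by apply: (HN n Nn s sss x (c_n _ (subc _ xc)) sxA); exact: ltnW.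
Qed.

Theorem theorem1p5 (R : realType) :
  exists A : set (space3 R),
    [/\ compact A, (0 < lebesgue_measure3 A)%E & ~ domain_of_expansion A].
Proof.
have mu_le (A B : set (space3 R)) :
    A `<=` B -> (lebesgue_measure3 A <= lebesgue_measure3 B)%E.
  exact: (@le_mu_ext _ _ _ (borel_lebesgue3 R) A B).
have p := scale_gt0 R 1.
(* The chunk of index 0 is a cube of side 4 rho_1 in which the gaps take up a
   length of at most rho_1 in the first direction. *)
have muA : ((48 * scale R 1 ^+ 3)%:E <= lebesgue_measure3 (rigid_set R))%E.
  apply: le_trans (mu_le _ _ (@chunk_rigid R 0)).
  have [||h _] := andP (@slab_measure R (moment_pt R 0) (2 * scale R 1) 1 _ _).
  - by rewrite mulr_ge0// ltW.
  - rewrite /moment_pt/= gtr0_norm ?scale_gt0//.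
    by have := scale_le16 R 0; have := scale_le16 R 1; lra.
  by apply: le_trans h; rewrite lee_fin; lra.
exists (rigid_set R); split; first exact: compact_rigid_set.
  by apply: lt_le_trans muA; rewrite lte_fin mulr_gt0// exprn_gt0.
move=> [S [eps [/finite_seqP[ss SE] SI eps0 expand]]].
pose moving := [seq s <- ss | `[< exists y, s y <> y >]].
have [|c [J [J1 cJ UA Uwander]]] := @wandering_slab R moving.
  move=> s; rewrite mem_filter => /andP[/asboolP sid sss]; split => //.
  by apply: SI; rewrite SE.
have pJ := scale_gt0 R J; have J1le := lt_scale R 1 J J1.
have r0 : 0 <= 2 * scale R J by rewrite mulr_ge0// ltW.
set U := slab c (2 * scale R J) J in UA Uwander.
have /andP[Ulo Uhi] := slab_measure _ c _ J r0 cJ; rewrite -/U in Ulo Uhi.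
have Upos : (0 < lebesgue_measure3 U)%E.
  apply: lt_le_trans Ulo; rewrite lte_fin mulr_gt0// ?exprn_gt0//; last by lra.
  by lra.
have Ufin : lebesgue_measure3 U \is a fin_num.
  by rewrite ge0_fin_numE ?(ltW Upos)// (le_lt_trans Uhi)// ltry.
have Uhalf : (lebesgue_measure3 U <= (2^-1)%:E * lebesgue_measure3 (rigid_set R))%E.
  apply: (le_trans Uhi); apply: (@le_trans _ _ ((2^-1)%:E * (48 * scale R 1 ^+ 3)%:E)%E).
    rewrite -EFinM lee_fin.
    have : scale R J ^+ 3 <= (scale R 1 / 4096) ^+ 3 by rewrite lerXn2r// nnegrE; lra.
    have := exprn_gt0 3 p; lra.
  by rewrite lee_wpmul2l.
have mU : lebesgue_measurable3 U.
  by apply: caratheodory_measurable_mu_ext; exact: slab_measurable.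
have := expand U mU UA Upos Uhalf; apply/negP; rewrite -leNgt.
apply: (@le_trans _ _ (lebesgue_measure3 U)).
  apply: mu_le => _ [s Ss [[x xU <-] sxA]].
  have [sid|sid] := pselect (exists y, s y <> y).
    exfalso; apply: (Uwander s x) => //; rewrite mem_filter; apply/andP; split.
      exact/asboolP.
    by move: Ss; rewrite SE.
  have -> // : s x = x by apply: contrapT => sx; apply: sid; exists x.
by rewrite lee_pemull ?(ltW Upos)// lee_fin lerDl ltW.
Qed.
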